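(* Let $*=e^{b_1h}=\sum_{n\ge 0}\frac{b_1^n}{n!}h^n\in C_2[[h]]$. Then $$[*,*]=0,$$ where the bracket is extended $k[[h]]$-bilinearly; equivalently, with $m_l=b_1^l/l!$, one has $\sum_{i+j=n,\ i,j\ge 0}[m_i,m_j]=0$ for every $n\ge 0$.
   Context: Graphs in the constant Poisson structure case. Let $k$ be a field of characteristic zero. For $m\ge 1$ consider directed graphs with $n\ge 0$ (unlabeled) internal vertices and $m$ boundary vertices labeled $1,\dots,m$; every internal vertex emits exactly two edges, labeled left and right, and boundary vertices emit none. Exchanging left and right at one internal vertex changes the sign of the graph (orientation classes). A graph in which both edges of an internal vertex have the same target is non-admissible and is set to zero; in the constant Poisson structure case a graph having an edge that lands on an internal vertex is also set to zero. Thus the space $C_m$ spanned by graphs with $m$ boundary vertices is the polynomial algebra $k[e_{pq}: 1\le p<q\le m]$, where $e_{pq}$ is the graph with one internal vertex whose left edge lands on $p$ and right edge on $q$, $e_{qp}=-e_{pq}$, $e_{pp}=0$, and the product superposes graphs with the same boundary vertices. Put $b_0=1\in C_2$ (no internal vertices, two boundary vertices), $b_1=e_{12}\in C_2$, and $b_1^n=e_{12}^n\in C_2$ (so $b_1^0=b_0$). For $\Gamma_1\in C_{m_1}$, $\Gamma_2\in C_{m_2}$, the graph insertion $\Gamma_1\circ_i\Gamma_2\in C_{m_1+m_2-1}$ replaces the $i$-th boundary vertex of $\Gamma_1$ by $\Gamma_2$ (whose boundary vertices become $i,\dots,i+m_2-1$, the later boundary vertices of $\Gamma_1$ being shifted by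 $m_2-1$), and sums over all ways of landing each edge of $\Gamma_1$ that pointed to $i$ on one of the boundary vertices $i,\dots,i+m_2-1$. Then $\Gamma_1\circ\Gamma_2=\sum_{i=1}^{m_1}(-1)^{(i-1)(m_2-1)}\Gamma_1\circ_i\Gamma_2$ and $[\Gamma_1,\Gamma_2]=\Gamma_1\circ\Gamma_2-(-1)^{(m_1-1)(m_2-1)}\Gamma_2\circ\Gamma_1$; in particular for $m_1=m_2=2$ one has $\Gamma_1\circ\Gamma_2=\Gamma_1\circ_1\Gamma_2-\Gamma_1\circ_2\Gamma_2$ and $[\Gamma_1,\Gamma_2]=\Gamma_1\circ\Gamma_2+\Gamma_2\circ\Gamma_1$. *)

(* Defs.v *)
From HB Require Import structures.
From mathcomp Require Import all_boot all_order all_algebra.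
From mathcomp Require Import mpoly.

Set Implicit Arguments.
Unset Strict Implicit.
Unset Printing Implicit Defensive.

Import GRing.Theory.
Local Open Scope ring_scope.

(* Boundary vertices are numbered from 0: the vertex labelled p + 1 is the
   element p of 'I_m. *)

Definition edge_pair (m : nat) := {pq : 'I_m * 'I_m | (pq.1 < pq.2)%N}.

(* C k m is the polynomial algebra k[e_pq : p < q]; its variable number v is
   e_pq for (p, q) = val (enum_val v). *)
Notation C k m := {mpoly k[#|{: edge_pair m}|]} (only parsing).

Definition e (k : fieldType) (m : nat) (p q : 'I_m) : C k m :=
  if insub (p, q) is Some v then 'X_(enum_rank (v : edge_pair m))
  else if insub (q, p) is Some v then - 'X_(enum_rank (v : edge_pair m))
  else 0.

(* A graph all of whose edges land on boundary vertices: one pair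
   (left target, right target) for each internal vertex.  The list order is
   immaterial for the class of the graph in C k m. *)
Definition graph (m : nat) := seq ('I_m * 'I_m).

Definition graph_class (k : fieldType) (m : nat) (g : graph m) : C k m :=
  \prod_(v <- g) e k v.1 v.2.

Definition graph_of_mnm (m : nat) (M : 'X_{1..#|{: edge_pair m}|}) : graph m :=
  flatten [seq nseq (M v) (val (enum_val v)) | v <- enum 'I_#|{: edge_pair m}|].

(* When the vertex i is replaced by m2 vertices, an edge that pointed to p may
   land on the new vertex r. *)
Definition may_land (m2 i p r : nat) : bool :=
  if (p < i)%N then r == p
  else if p == i then (i <= r < i + m2)%N
  else r == (p + m2).-1.

Lemma shift_subproof (m1 m2 : nat) (i : 'I_m1) (j : 'I_m2) :
  (i + j < (m1 + m2).-1)%N.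
Proof.
case: m1 i => [[] //|m1] i; case: m2 j => [[] //|m2] j.
by rewrite addnS /= ltnS leq_add // -ltnS.
Qed.

Definition shift (m1 m2 : nat) (i : 'I_m1) (j : 'I_m2) : 'I_(m1 + m2).-1 :=
  Ordinal (shift_subproof i j).

(* f chooses the new pair of targets of every internal vertex of g1. *)
Definition insert_graph (k : fieldType) (m1 m2 : nat) (i : 'I_m1)
    (g1 : graph m1) (g2 : graph m2) : C k (m1 + m2).-1 :=
  \sum_(f : {ffun 'I_(size g1) -> 'I_(m1 + m2).-1 * 'I_(m1 + m2).-1} |
        [forall v, may_land m2 i (tnth (in_tuple g1) v).1 (f v).1 &&
                   may_land m2 i (tnth (in_tuple g1) v).2 (f v).2])
     graph_class k (codom f ++ [seq (shift i w.1, shift i w.2) | w <- g2]).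

Definition insert (k : fieldType) (m1 m2 : nat) (i : 'I_m1)
    (P : C k m1) (Q : C k m2) : C k (m1 + m2).-1 :=
  \sum_(M <- msupp P) \sum_(N <- msupp Q)
     (P@_M * Q@_N) *: insert_graph k i (graph_of_mnm M) (graph_of_mnm N).

Definition circ (k : fieldType) (m1 m2 : nat) (P : C k m1) (Q : C k m2) :
    C k (m1 + m2).-1 :=
  \sum_(i < m1) (-1) ^+ (i * m2.-1) * insert i P Q.

(* Q o P lives in C k (m2 + m1).-1 and is transported along commutativity
   of addition. *)
Definition bracket (k : fieldType) (m1 m2 : nat) (P : C k m1) (Q : C k m2) :
    C k (m1 + m2).-1 :=
  circ P Q - (-1) ^+ (m1.-1 * m2.-1) *
    ecast m (C k m) (congr1 predn (addnC m2 m1)) (circ Q P).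

(* V[[h]]: the value at n is the coefficient of h^n. *)
Definition fps (V : Type) := nat -> V.

Definition bracket_fps (k : fieldType) (m1 m2 : nat)
    (F : fps (C k m1)) (G : fps (C k m2)) : fps (C k (m1 + m2).-1) :=
  fun n => \sum_(ij : 'I_n.+1 * 'I_n.+1 | (ij.1 + ij.2 == n)%N)
             bracket (F ij.1) (G ij.2).

Definition b1 (k : fieldType) : C k 2 := e k ord0 ord_max.

Definition star (k : fieldType) : fps (C k 2) :=
  fun n => (n`!%:R)^-1 *: b1 k ^+ n.

(* Well-definedness: insertion computed on monomials agrees with insertion of
   arbitrary representing graphs, whatever the order of their internal vertices
   and the left-right orientation of their edges. *)

Section WellDefined.
Variable k : fieldType.

Lemma eE m (v : edge_pair m) :
  e k (val v).1 (val v).2 = 'X_(enum_rank v).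
Proof. by rewrite /e -surjective_pairing valK. Qed.

Lemma e_anti m (p q : 'I_m) : e k q p = - e k p q.
Proof.
rewrite /e; case: insubP => [u qp _|nqp]; case: insubP => [v pq _|npq];
  rewrite ?opprK ?oppr0 //.
by move: (ltn_trans pq qp); rewrite ltnn.
Qed.

Lemma e_diag m (p : 'I_m) : e k p p = 0.
Proof. by rewrite /e; case: insubP => //= u; rewrite ltnn. Qed.

Definition blow m1 m2 (i : 'I_m1) (v : 'I_m1 * 'I_m1) : C k (m1 + m2).-1 :=
  \sum_(r : 'I_(m1 + m2).-1 * 'I_(m1 + m2).-1 |
        may_land m2 i v.1 r.1 && may_land m2 i v.2 r.2) e k r.1 r.2.

Lemma blow_anti m1 m2 (i p q : 'I_m1) : @blow m1 m2 i (q, p) = - blow m2 i (p, q).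
Proof.
rewrite /blow -sumrN (reindex_inj (h := fun r => (r.2, r.1))) /=; last first.
  by move=> [a b] [c d] /= [-> ->].
by apply: eq_big => [r|r _]; rewrite 1?andbC // e_anti.
Qed.

Lemma blow_diag m1 m2 (i p : 'I_m1) : @blow m1 m2 i (p, p) = 0.
Proof.
rewrite /blow (bigID (fun r : 'I_(m1 + m2).-1 * 'I_(m1 + m2).-1 => (r.1 < r.2)%N)) /=.
rewrite [X in _ + X](bigID (fun r : 'I_(m1 + m2).-1 * 'I_(m1 + m2).-1 => (r.2 < r.1)%N)) /= [X in _ + (_ + X)]big1 ?addr0.
  rewrite [X in _ + X](reindex_inj (h := fun r => (r.2, r.1))) /=; last first.
    by move=> [a b] [c d] /= [-> ->].
  rewrite -[X in X + _]opprK -sumrN addrC; apply/eqP; rewrite subr_eq0; apply/eqP.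
  apply: eq_big => [r|r _]; last by rewrite e_anti.
  by rewrite [may_land _ _ _ r.2 && _]andbC; case: ltngtP; rewrite ?andbF ?andbT.
move=> [a b] /= /andP[/andP[_]]; rewrite -!leqNgt => ab ba.
by rewrite (_ : a = b) ?e_diag //; apply/val_inj/eqP; rewrite eqn_leq ab ba.
Qed.

Lemma insert_graphE m1 m2 (i : 'I_m1) (g1 : graph m1) (g2 : graph m2) :
  insert_graph k i g1 g2 =
  (\prod_(v <- g1) blow m2 i v) * \prod_(w <- g2) e k (shift i w.1) (shift i w.2).
Proof.
rewrite /insert_graph /graph_class.
under [LHS]eq_bigr => f _ do rewrite big_cat /= big_map.
rewrite -mulr_suml; congr (_ * _).
rewrite [RHS]big_tnth bigA_distr_big_dep /=.
apply: eq_big => [f|f _]; last by rewrite codomE big_map big_enum.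
by apply/forallP/familyP => H v; apply: H.
Qed.

Lemma graph_of_mnm_prod m (R : comNzRingType) (F : 'I_m * 'I_m -> R) M :
  \prod_(v <- graph_of_mnm M) F v =
  mmap1 (fun v => F (val (enum_val v))) M.
Proof.
rewrite /graph_of_mnm big_flatten /= big_map big_enum /=.
by apply: eq_bigr => v _; rewrite big_nseq iter_mulr_1.
Qed.

Lemma insert_class m1 m2 (i : 'I_m1) (g1 : graph m1) (g2 : graph m2) :
  insert i (graph_class k g1) (graph_class k g2) = insert_graph k i g1 g2.
Proof.
pose hp (v : 'I_#|{: edge_pair m1}|) : C k (m1 + m2).-1 := blow m2 i (val (enum_val v)).
pose hq (v : 'I_#|{: edge_pair m2}|) : C k (m1 + m2).-1 :=
  let w := val (enum_val v) in e k (shift i w.1) (shift i w.2).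
have -> : insert i (graph_class k g1) (graph_class k g2) =
  mmap (@mpolyC _ k) hp (graph_class k g1) * mmap (@mpolyC _ k) hq (graph_class k g2).
  rewrite /insert /mmap mulr_suml; apply: eq_bigr => M _.
  rewrite mulr_sumr; apply: eq_bigr => N _.
  rewrite insert_graphE (graph_of_mnm_prod (fun v => blow m2 i v)).
  rewrite (graph_of_mnm_prod (fun w => e k (shift i w.1) (shift i w.2))).
  by rewrite -mul_mpolyC mpolyCM mulrACA.
rewrite insert_graphE /graph_class !rmorph_prod /=.
have eC m (h : 'I_#|{: edge_pair m}| -> C k (m1 + m2).-1) (F : 'I_m * 'I_m -> C k (m1 + m2).-1) :
    (forall v, h v = F (val (enum_val v))) -> (forall p q, F (q, p) = - F (p, q)) ->
    (forall p, F (p, p) = 0) -> forall v, mmap (@mpolyC _ k) h (e k v.1 v.2) = F v.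
  move=> hF Fanti Fdiag [p q] /=.
  have lt (a b : 'I_m) : (a < b)%N -> mmap (@mpolyC _ k) h (e k a b) = F (a, b).
    move=> ab; have := eE (exist _ (a, b) ab : edge_pair m); rewrite /= => ->.
    by rewrite mmapX mmap1U hF enum_rankK.
  case: (ltngtP p q) => [/lt //|qp|/val_inj->]; last by rewrite e_diag raddf0 Fdiag.
  by rewrite e_anti raddfN /= lt // Fanti.
congr (_ * _); apply: eq_bigr => v _.
  by apply: (eC _ _ (blow m2 i)) => //; [exact: blow_anti | exact: blow_diag].
apply: (eC _ _ (fun w => e k (shift i w.1) (shift i w.2))) => //= *.
  exact: e_anti.
exact: e_diag.
Qed.

End WellDefined.

(* Main.v *)
Require Import Defs.
From mathcomp Require Import all_boot all_order all_algebra.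
From mathcomp Require Import mpoly.

Import GRing.Theory.
Local Open Scope ring_scope.

(** The insertion of Q at the vertex i of P is the product of the images of P
    and of Q under two algebra morphisms ([insert_mmap]).  With the boundary
    vertices numbered from 0, let x, y, z be the generators e_01, e_02, e_12 of
    C_3.  The insertion of e_01^b at the first vertex of e_01^a is then
    (y + z)^a x^b, and its insertion at the second vertex is (x + y)^a z^b; in
    the circle product they have opposite signs ([circ_b1]).  Since k has
    characteristic zero, the binomial formula for divided powers
    ([divided_power_addn]) shows that the sum over a + b = n of each of the two,
    with the weight 1 / (a! b!), is (x + y + z)^n / n!.  So the circle product
    of the star product with itself vanishes ([circ_star]), and the bracket is
    twice this circle product. *)

Lemma sum_antidiagonal (V : nmodType) (n : nat) (F : nat -> nat -> V) :
  \sum_(ij : 'I_n.+1 * 'I_n.+1 | (ij.1 + ij.2 == n)%N) F ij.1 ij.2 =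
  \sum_(j < n.+1) F (n - j)%N j.
Proof.
rewrite -(pair_big_dep xpredT (fun i j : 'I_n.+1 => i + j == n)%N
  (fun i j => F i j)) (exchange_big_dep xpredT) //=.
apply: eq_bigr => j _; rewrite (big_pred1 (rev_ord j)) /= ?subSS // => i.
apply/eqP/eqP => [ijn|->]; last by rewrite /= subSS subnK // -ltnS.
by apply: val_inj; rewrite /= subSS -[X in (X - j)%N]ijn addnK.
Qed.

Lemma divided_power_addn (k : fieldType) (A : comAlgType k)
    (char0 : [pchar k] =i pred0) (n : nat) (x y : A) :
  \sum_(j < n.+1) ((n - j)`!%:R^-1 * j`!%:R^-1) *: (x ^+ (n - j) * y ^+ j) =
  n`!%:R^-1 *: (x + y) ^+ n.
Proof.
have fact_neq0 m : m`!%:R != 0 :> k by rewrite ((GRing.pcharf0P k).1 char0) -lt0n fact_gt0.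
rewrite exprDn scaler_sumr; apply: eq_bigr => j _.
rewrite -scaler_nat scalerA; congr (_ *: _).
have le_jn : (j <= n)%N by rewrite -ltnS.
have bin_neq0 : 'C(n, j)%:R != 0 :> k.
  apply: contraNneq (fact_neq0 n) => bin0.
  by rewrite -(bin_fact le_jn) natrM bin0 mul0r.
by rewrite -(bin_fact le_jn) !natrM !invfM mulrC [RHS]mulrC mulVKf.
Qed.

Section MoyalGraphs.
Variable k : fieldType.

Lemma insert_mmap (m1 m2 : nat) (i : 'I_m1) (P : C k m1) (Q : C k m2) :
  insert i P Q =
  mmap (@mpolyC _ k) (fun v => blow k m2 i (val (enum_val v))) P *
  mmap (@mpolyC _ k) (fun v => e k (shift i (val (enum_val v)).1)
                                   (shift i (val (enum_val v)).2)) Q.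
Proof.
rewrite /insert [mmap _ _ P]/mmap mulr_suml; apply: eq_bigr => M _.
rewrite [mmap _ _ Q]/mmap mulr_sumr; apply: eq_bigr => N _.
rewrite insert_graphE (graph_of_mnm_prod (fun v => blow k m2 i v)).
rewrite (graph_of_mnm_prod (fun w => e k (shift i w.1) (shift i w.2))).
by rewrite -mul_mpolyC mpolyCM mulrACA.
Qed.

Lemma insert_b1 (i : 'I_2) (a b : nat) (c d : k) :
  insert i (c *: b1 k ^+ a) (d *: b1 k ^+ b) =
  (c * d) *: (blow k 2 i (ord0, ord_max) ^+ a *
              e k (shift i ord0) (shift i ord_max) ^+ b).
Proof.
have b1E : b1 k = 'X_(enum_rank (exist _ (ord0, ord_max) isT : edge_pair 2)).
  by rewrite -eE.
rewrite insert_mmap !mmapZ !rmorphXn /= b1E !mmapX !mmap1U !enum_rankK /=.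
by rewrite !mul_mpolyC -scalerAl -scalerAr scalerA.
Qed.

Let v0 : 'I_3 := inord 0.
Let v1 : 'I_3 := inord 1.
Let v2 : 'I_3 := inord 2.
Let x : C k 3 := e k v0 v1.
Let y : C k 3 := e k v0 v2.
Let z : C k 3 := e k v1 v2.

Lemma sum3 (F : 'I_3 * 'I_3 -> C k 3) (P : pred nat) (Q : pred nat) :
  \sum_(r : 'I_3 * 'I_3 | P r.1 && Q r.2) F r =
  \sum_(p <- [:: v0; v1; v2] | P p) \sum_(q <- [:: v0; v1; v2] | Q q) F (p, q).
Proof.
have E : [:: v0; v1; v2] = enum 'I_3.
  by apply: (inj_map val_inj); rewrite val_enum_ord /= !inordK.
rewrite E big_enum_cond; under [RHS]eq_bigr do rewrite big_enum_cond.
by rewrite pair_big /=; apply: eq_bigr => -[].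
Qed.

(** [blow] sums over the targets on which the edges of a vertex of the outer
    graph may land.  Inserting at 0, the edge to 0 lands on 0 or 1 and the edge
    to 1 moves to 2. *)
Lemma blow_first : blow k 2 (ord0 : 'I_2) (ord0, ord_max) = y + z :> C k 3.
Proof.
rewrite /blow (sum3 _ (may_land 2 0 0) (may_land 2 0 1)).
rewrite !big_cons !big_nil /may_land /= !inordK //=.
by rewrite !addr0.
Qed.

(** Inserting at 1, the edge to 0 stays and the edge to 1 lands on 1 or 2. *)
Lemma blow_second : blow k 2 (ord_max : 'I_2) (ord0, ord_max) = x + y :> C k 3.
Proof.
rewrite /blow (sum3 _ (may_land 2 1 0) (may_land 2 1 1)).
rewrite !big_cons !big_nil /may_land /= !inordK //=.
by rewrite !addr0.
Qed.

Lemma circ_b1 (a b : nat) (c d : k) :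
  circ (c *: b1 k ^+ a) (d *: b1 k ^+ b) =
  (c * d) *: ((y + z) ^+ a * x ^+ b) - (c * d) *: ((x + y) ^+ a * z ^+ b)
  :> C k 3.
Proof.
have shiftE (i j : 'I_2) : shift i j = inord (i + j) :> 'I_3.
  by apply: val_inj; rewrite /= inordK // (shift_subproof i j).
rewrite /circ (big_ord_recl 1) big_ord1 /= expr0 mul1r mulN1r.
rewrite (_ : lift ord0 ord0 = ord_max :> 'I_2); last exact: val_inj.
by rewrite !insert_b1 blow_first blow_second !shiftE.
Qed.

(** On C_2 the sign of the second term of the bracket is -(-1)^1, and the
    transport along 2 + 2 = 2 + 2 is trivial. *)
Lemma bracket2 (P Q : C k 2) : bracket P Q = circ P Q + circ Q P :> C k 3.
Proof.
rewrite /bracket /= expr1 mulN1r opprK; congr (_ + _).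
by rewrite (eq_axiomK (congr1 predn (addnC 2 2))).
Qed.

(** The star product is associative. *)
Lemma circ_star (char0 : [pchar k] =i pred0) (n : nat) :
  \sum_(ij : 'I_n.+1 * 'I_n.+1 | (ij.1 + ij.2 == n)%N)
    circ (star k ij.1) (star k ij.2) = 0 :> C k 3.
Proof.
rewrite (sum_antidiagonal _ n (fun a b => circ (star k a) (star k b))).
under eq_bigr do rewrite circ_b1.
by rewrite sumrB !divided_power_addn // addrC [y + z + x]addrC addrA addNr.
Qed.

Lemma bracket_star (char0 : [pchar k] =i pred0) (n : nat) :
  bracket_fps (star k) (star k) n = 0.
Proof.
rewrite /bracket_fps; under eq_bigr do rewrite bracket2.
rewrite big_split /= circ_star // add0r.
rewrite (reindex_inj (h := fun ij => (ij.2, ij.1))) /=; last first.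
  by move=> [i j] [i' j'] [-> ->].
by under eq_bigl do rewrite addnC; exact: circ_star.
Qed.

End MoyalGraphs.

Theorem proposition5 (k : fieldType) (char0 : [pchar k] =i pred0) :
  (forall n : nat, bracket_fps (star k) (star k) n = 0) /\
  (forall n : nat,
     \sum_(ij : 'I_n.+1 * 'I_n.+1 | (ij.1 + ij.2 == n)%N)
       bracket ((ij.1`!%:R)^-1 *: b1 k ^+ ij.1)
               ((ij.2`!%:R)^-1 *: b1 k ^+ ij.2) = 0).
Proof. by split=> n; exact: bracket_star. Qed.
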